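(* Let $g>0$, $c_L,c_R>0$, $u_L,u_R,a_L,a_R\in\mathbb{R}$, and put $\hat u=\frac{u_L+u_R}{2}$, $\hat c=\frac{c_L+c_R}{2}$, $\hat\lambda_1=\hat u-\hat c$, $\hat\lambda_2=\hat u+\hat c$. Suppose that $u_R-u_L<2(c_R+c_L)$ and $\hat\lambda_1<0<\hat\lambda_2$. Choose the wave speeds $\lambda_1,\lambda_2$ as follows: $$\text{if } a_R>a_L:\qquad \lambda_1=\hat\lambda_1,\qquad \lambda_2=\max\left(\hat\lambda_2,\ \frac{g(a_R-a_L)}{2(c_R+c_L)-(u_R-u_L)}\right);$$ $$\text{if } a_R<a_L:\qquad \lambda_1=\min\left(\hat\lambda_1,\ \frac{g(a_R-a_L)}{2(c_R+c_L)-(u_R-u_L)}\right),\qquad \lambda_2=\hat\lambda_2.$$ Then in both cases the intermediate state $Y^*$ of the approximate Riemann solver with wave speeds $\lambda_1,\lambda_2$ (fluvial configuration) has nonnegative celerity, i.e. $c^*_l\ge 0$ and $c^*_r\ge 0$.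
   Context: Setting: one-dimensional shallow-water equations with topography in celerity-velocity variables $Y=(2c,u,a)^T$, where $c=\sqrt{gh}$ is the celerity ($h$ water height), $u$ the velocity, $a$ the bottom height and $g>0$ the gravitational acceleration. At an interface, with left state $Y_L=(2c_L,u_L,a_L)^T$ and right state $Y_R=(2c_R,u_R,a_R)^T$ (outside dry zones, so $c_L,c_R>0$), one considers the linearized Riemann problem $\partial_tY+A(\hat Y)\partial_xY=0$, $Y(x,0)=Y_L$ for $x<0$ and $Y_R$ for $x>0$, where $A(Y)=\begin{pmatrix}u&c&0\\c&u&g\\0&0&0\end{pmatrix}$ and $\hat Y=\frac{Y_L+Y_R}{2}$. The eigenvalues of $A(\hat Y)$ are $0$, $\hat\lambda_1=\hat u-\hat c$ and $\hat\lambda_2=\hat u+\hat c$. Approximate solver with wave speeds $\lambda_1<0<\lambda_2$ (fluvial configuration; $\lambda_1,\lambda_2$ replace $\hat\lambda_1,\hat\lambda_2$): let $$r_1=(-1,1,0)^T,\quad r_2=(1,1,0)^T,\quad l_1=\left(-\tfrac12,\tfrac12,\tfrac{g}{2\lambda_1}\right)^T,\quad l_2=\left(\tfrac12,\tfrac12,\tfrac{g}{2\lambda_2}\right)^T .$$ The intermediate state $Y^*$ consists of the two states on the left and right of the interface $x=0$, $$Y^*_l=Y_L+\big(l_1\cdot(Y_R-Y_L)\big)r_1,\qquad Y^*_r=Y_R-\big(l_2\cdot(Y_R-Y_L)\big)r_2 ,$$ and its celerities $c^*_l,c^*_r$ are defined by letting $2c^*_l$ and $2c^*_r$ be the first components of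 $Y^*_l$ and $Y^*_r$; that is, $$2c^*_l=\tfrac12\left(2(c_R+c_L)-(u_R-u_L)-\frac{g(a_R-a_L)}{\lambda_1}\right),\qquad 2c^*_r=\tfrac12\left(2(c_R+c_L)-(u_R-u_L)-\frac{g(a_R-a_L)}{\lambda_2}\right).$$ *)

(* Defs.v *)
From mathcomp Require Import all_boot all_order all_algebra.
From mathcomp Require Import reals.

Set Implicit Arguments.
Unset Strict Implicit.
Unset Printing Implicit Defensive.

Import Order.TTheory GRing.Theory Num.Theory.
Local Open Scope ring_scope.

Section ShallowWater.
Variable R : realType.
Implicit Types (g c u a lambda : R) (Y : 'cV[R]_3).

Definition vec3 (x y z : R) : 'cV[R]_3 := \col_i [:: x; y; z]`_i.

Definition dotv (v w : 'cV[R]_3) : R := (v^T *m w) 0 0.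

(* The celerity-velocity variables are (2c, u, a)^T: the first component is
   twice the celerity. *)
Definition state c u a : 'cV[R]_3 := vec3 (2 * c) u a.
Definition celerity Y : R := Y 0 0 / 2.
Definition velocity Y : R := Y 1 0.

Definition mean_state (YL YR : 'cV[R]_3) : 'cV[R]_3 := 2^-1 *: (YL + YR).

(* The nonzero eigenvalues u -+ c of
   A(Y) = [u, c, 0; c, u, g; 0, 0, 0], taken at the mean state. *)
Definition lambda_hat1 (YL YR : 'cV[R]_3) : R :=
  velocity (mean_state YL YR) - celerity (mean_state YL YR).
Definition lambda_hat2 (YL YR : 'cV[R]_3) : R :=
  velocity (mean_state YL YR) + celerity (mean_state YL YR).

Definition r1 : 'cV[R]_3 := vec3 (-1) 1 0.
Definition r2 : 'cV[R]_3 := vec3 1 1 0.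
Definition l1 g lambda1 : 'cV[R]_3 :=
  vec3 (- (1 / 2)) (1 / 2) (g / (2 * lambda1)).
Definition l2 g lambda2 : 'cV[R]_3 :=
  vec3 (1 / 2) (1 / 2) (g / (2 * lambda2)).

(* Intermediate state on either side of the interface x = 0, in the fluvial
   configuration lambda1 < 0 < lambda2. *)
Definition Ystar_l g lambda1 (YL YR : 'cV[R]_3) : 'cV[R]_3 :=
  YL + dotv (l1 g lambda1) (YR - YL) *: r1.
Definition Ystar_r g lambda2 (YL YR : 'cV[R]_3) : 'cV[R]_3 :=
  YR - dotv (l2 g lambda2) (YR - YL) *: r2.

End ShallowWater.

(* Main.v *)
Require Import Defs.
From mathcomp Require Import all_boot all_order all_algebra.
From mathcomp Require Import reals.
From mathcomp Require Import lra.

(** Write D = 2 (cR + cL) - (uR - uL), which is positive by assumption, and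
    da = aR - aL.  Expanding the solver gives, on both sides of the interface,
    the same formula: the celerity is (D - g da / lambda) / 4, with lambda the
    wave speed of that side ([celerity_Ystar_l], [celerity_Ystar_r]).  It is
    therefore nonnegative iff g da / lambda <= D, and since D > 0 this amounts
    to comparing lambda with the critical speed g da / D: lambda2 must lie above
    it and lambda1 below it.  On the side where the speed is modified, the
    maximum or minimum imposes exactly this comparison; on the other side, the
    critical speed and the speed have opposite signs, so the comparison is
    automatic. *)

Set Implicit Arguments.
Unset Strict Implicit.
Unset Printing Implicit Defensive.

Import Order.TTheory GRing.Theory Num.Theory.
Local Open Scope ring_scope.

Lemma celerity_Ystar_l (R : realType) (g lambda cL cR uL uR aL aR : R) :
  celerity (Ystar_l g lambda (state cL uL aL) (state cR uR aR)) =
  (2 * (cR + cL) - (uR - uL) - g * (aR - aL) / lambda) / 4.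
Proof.
rewrite /celerity /Ystar_l /dotv !mxE !big_ord_recr big_ord0 /= !mxE /=.
(* With the inverse split, the identity is polynomial in lambda^-1, so it also
   holds for lambda = 0. *)
by rewrite invfM; lra.
Qed.

Lemma celerity_Ystar_r (R : realType) (g lambda cL cR uL uR aL aR : R) :
  celerity (Ystar_r g lambda (state cL uL aL) (state cR uR aR)) =
  (2 * (cR + cL) - (uR - uL) - g * (aR - aL) / lambda) / 4.
Proof.
rewrite /celerity /Ystar_r /dotv !mxE !big_ord_recr big_ord0 /= !mxE /=.
by rewrite invfM; lra.
Qed.

(** A positive divisor and a positive bound can be exchanged, both statements
    being x <= d * lambda. *)
Lemma ler_div_swap (R : realFieldType) (x d lambda : R) :
  0 < d -> 0 < lambda -> (x / lambda <= d) = (x / d <= lambda).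
Proof. by move=> d0 l0; rewrite !ler_pdivrMr // mulrC. Qed.

(** Here only the multiplication by lambda reverses the inequality, so the
    exchanged comparison changes direction. *)
Lemma ler_div_swap_neg (R : realFieldType) (x d lambda : R) :
  0 < d -> lambda < 0 -> (x / lambda <= d) = (lambda <= x / d).
Proof. by move=> d0 l0; rewrite ler_ndivrMr // ler_pdivlMr // mulrC. Qed.

Theorem proposition4p3 (R : realType) (g cL cR uL uR aL aR : R)
    (g_gt0 : 0 < g) (cL_gt0 : 0 < cL) (cR_gt0 : 0 < cR)
    (YL := state cL uL aL) (YR := state cR uR aR)
    (du_lt : uR - uL < 2 * (cR + cL))
    (lambda_hat1_lt0 : lambda_hat1 YL YR < 0)
    (lambda_hat2_gt0 : 0 < lambda_hat2 YL YR)
    (lambda1 lambda2 : R)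
    (speeds :
      [/\ aL < aR,
          lambda1 = lambda_hat1 YL YR &
          lambda2 = Num.max (lambda_hat2 YL YR)
                      (g * (aR - aL) / (2 * (cR + cL) - (uR - uL)))] \/
      [/\ aR < aL,
          lambda1 = Num.min (lambda_hat1 YL YR)
                      (g * (aR - aL) / (2 * (cR + cL) - (uR - uL))) &
          lambda2 = lambda_hat2 YL YR]) :
  0 <= celerity (Ystar_l g lambda1 YL YR) /\
  0 <= celerity (Ystar_r g lambda2 YL YR).
Proof.
rewrite celerity_Ystar_l celerity_Ystar_r.
move: speeds lambda_hat1_lt0 lambda_hat2_gt0; rewrite {}/YL {}/YR.
set h1 := lambda_hat1 _ _; set h2 := lambda_hat2 _ _.
set D := 2 * (cR + cL) - (uR - uL) => speeds h1_lt0 h2_gt0.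
have D_gt0 : 0 < D by rewrite subr_gt0.
suff [l1_lt0 l1_le l2_gt0 l2_ge] :
    [/\ lambda1 < 0, lambda1 <= g * (aR - aL) / D,
        0 < lambda2 & g * (aR - aL) / D <= lambda2].
  split; apply: divr_ge0 => //; rewrite subr_ge0.
    by rewrite ler_div_swap_neg.
  by rewrite ler_div_swap.
case: speeds => -[da -> ->].
- have crit_gt0 : 0 < g * (aR - aL) / D.
    by rewrite divr_gt0 // mulr_gt0 // subr_gt0.
  split; rewrite ?lt_max ?le_max ?lexx ?h2_gt0 ?orbT //.
  exact: ltW (lt_trans h1_lt0 crit_gt0).
- have crit_lt0 : g * (aR - aL) / D < 0.
    by rewrite pmulr_llt0 ?invr_gt0 // pmulr_rlt0 // subr_lt0.
  split; rewrite ?gt_min ?ge_min ?lexx ?h1_lt0 ?orbT //.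
  exact: ltW (lt_trans crit_lt0 h2_gt0).
Qed.
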